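(* For every $n\in\mathbb{N}$ and every $a=(a_1,\ldots,a_n)\in[0,\infty[^n$, $$ f_{\mathrm{MG}}(a)\;=\;\max\left(\Big\{a_k-\sum_{i=1}^{k-1}a_i \,:\, 1\le k\le n\Big\}\;\cup\;\Big\{\frac{a_k}{2}\,:\,3\le k\le n\Big\}\right), $$ where $$ f_{\mathrm{MG}}(a):=\inf\Big\{\mathbb{E}|S_n| \,:\, (S_1,\ldots,S_n)\text{ is a martingale},\ \mathbb{E}|X_1|=a_1,\ldots,\mathbb{E}|X_n|=a_n\Big\}, $$ the infimum being over all processes $(X_1,\ldots,X_n)$ of real-valued random variables (on arbitrary probability spaces) with the indicated properties, and $S_k:=\sum_{i=1}^k X_i$ for $k\in\{0,\ldots,n\}$.
   Context: $\mathbb{N}=\{1,2,3,\ldots\}$. For a process $(X_1,\ldots,X_n)$ of real-valued random variables, $S_k:=\sum_{i=1}^k X_i$ for $k\in\{0,\ldots,n\}$, so $S_0=0$. ''$(S_1,\ldots,S_n)$ is a martingale'' is understood with respect to the natural filtration, i.e. the $X_i$ are integrable and $\mathbb{E}(X_i\mid X_1,\ldots,X_{i-1})=0$ for $i\in\{2,\ldots,n\}$ (there is no requirement that $\mathbb{E}X_1=0$). Since everything depends only on the law of $(X_1,\ldots,X_n)$, the infimum can formally be taken over the set of probability measures $P$ on $\mathbb{R}^n$ under which the coordinate process $(X_1,\ldots,X_n)=\mathrm{id}_{\mathbb{R}^n}$ has the stated properties. The set $\{a_k/2: 3\le k\le n\}$ is empty if $n<3$, and empty sums are $0$. *)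

(* Defs.v *)
From HB Require Import structures.
From mathcomp Require Import all_boot all_order all_algebra.
From mathcomp Require Import all_classical all_reals all_analysis.

Set Implicit Arguments.
Unset Strict Implicit.
Unset Printing Implicit Defensive.

Import Order.TTheory GRing.Theory Num.Theory.
Import numFieldNormedType.Exports.

Local Open Scope classical_set_scope.
Local Open Scope ring_scope.
Local Open Scope ereal_scope.

(* Indices are shifted by one: a process (X_1, ..., X_n) and a vector
   (a_1, ..., a_n) are functions on 'I_n, the ordinal k standing for k + 1. *)

(* Y is a version of the conditional expectation of X given the
   sub-sigma-algebra G (Kolmogorov's definition). *)
Definition is_cond_expectation (R : realType) (d : measure_display)
    (T : measurableType d) (P : probability T R) (G : set_system T)
    (X Y : T -> R) : Prop :=
  [/\ forall B : set R, measurable B -> G (Y @^-1` B),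
      P.-integrable setT (EFin \o Y) &
      forall A : set T, G A ->
        \int[P]_(w in A) (Y w)%:E = \int[P]_(w in A) (X w)%:E].

Definition sigma_past (R : realType) (d : measure_display)
    (T : measurableType d) (P : probability T R) (n : nat)
    (X : 'I_n -> {RV P >-> R}) (i : 'I_n) : set_system T :=
  g_sigma_preimage
    (fun j : 'I_i => X (widen_ord (ltnW (ltn_ord i)) j) : T -> R).

(* The partial sums of X form a martingale for the natural filtration. The
   first increment is not required to be centred, hence the guard 0 < i. *)
Definition martingale_sums (R : realType) (d : measure_display)
    (T : measurableType d) (P : probability T R) (n : nat)
    (X : 'I_n -> {RV P >-> R}) : Prop :=
  (forall i : 'I_n, P.-integrable setT (EFin \o X i)) /\
  (forall i : 'I_n, (0 < i)%N ->
     is_cond_expectation P (sigma_past X i) (X i) (cst 0%R)).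

(* The infimum is taken in \bar R, so that it is +oo (and not a real junk
   value) if no process is admissible. *)
Definition f_MG (R : realType) (n : nat) (a : 'I_n -> R) : \bar R :=
  ereal_inf [set e : \bar R |
    exists (d : measure_display) (T : measurableType d) (P : probability T R)
           (X : 'I_n -> {RV P >-> R}),
      [/\ martingale_sums X,
          forall i : 'I_n, 'E_P[fun w => `|X i w|%R] = (a i)%:E &
          e = 'E_P[fun w => `|(\sum_(i < n) X i w)%R|%R]]].

(* Main.v *)
(* Lower bound: E|S_k| is nondecreasing in k (test the martingale property on
   {S_k >= 0} and its complement), so a_k <= E|S_k| + E|S_(k-1)| gives both
   a_k - (a_1 + ... + a_(k-1)) <= E|S_n| and a_k / 2 <= E|S_n|.

   Upper bound: if E|S_(k-1)| = s > 0, multiplying S_(k-1) by 1 + Z, with Z an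
   independent centred two-valued variable, realises E|X_k| = a_k and
   E|S_k| = t for every t with s <= t < s + a_k and s + t > a_k. It remains to
   choose moments obeying these inequalities and ending below M + e, where M is
   the claimed value of the infimum. *)
Require Import Defs.
From HB Require Import structures.
From mathcomp Require Import all_boot all_order all_algebra.
From mathcomp Require Import all_classical all_reals all_analysis.
From mathcomp Require Import measurable_realfun ring lra.

Import Order.TTheory GRing.Theory Num.Theory.
Import numFieldNormedType.Exports.

Local Open Scope classical_set_scope.
Local Open Scope ring_scope.
Local Open Scope ereal_scope.

(** * Growth of first absolute moments, and the lower bound *)

(** As [X] is centred on [A], the functions [e * S] and [e * (S + X)] have the same integral there,
    and the latter is at most [|S + X|]. *)
Lemma le_integral_norm_centered_signed (d : measure_display)
    (T : measurableType d) (R : realType) (mu : {measure set T -> \bar R})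
    (A : set T) (S X : T -> R) (e : R) :
  measurable A ->
  mu.-integrable A (EFin \o S) -> mu.-integrable A (EFin \o X) ->
  \int[mu]_(w in A) (X w)%:E = 0 ->
  `|e|%R = 1%R -> (forall w, A w -> `|S w|%R = (e * S w)%R) ->
  \int[mu]_(w in A) `|S w|%R%:E <= \int[mu]_(w in A) `|S w + X w|%R%:E.
Proof.
move=> mA iS iX X0 e1 Se.
have iN : mu.-integrable A (fun w => e%:E * (X w)%:E) by exact: integrableZl.
have iaS := integrable_norm iS.
have iSX : mu.-integrable A (EFin \o (fun w => `|S w + X w|%R)).
  exact: (@integrable_norm _ _ _ _ _ (S \+ X)%R (integrableD mA iS iX)).
have -> : \int[mu]_(w in A) `|S w|%R%:E =
    \int[mu]_(w in A) (`|S w|%R%:E + e%:E * (X w)%:E).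
  by rewrite integralD// integralZl// X0 mule0 adde0.
apply: le_integral => //; first exact: integrableD.
move=> w /set_mem Aw /=; rewrite -EFinM -EFinD lee_fin Se// -mulrDr.
by rewrite (le_trans (ler_norm _))// normrM e1 mul1r.
Qed.

(* A martingale step does not decrease the first absolute moment: it suffices
   that the increment X is centred on the two sets where S has constant sign. *)
Lemma le_integral_norm_centered (d : measure_display)
    (T : measurableType d) (R : realType) (mu : {measure set T -> \bar R})
    (S X : T -> R) (A := [set w | (0 <= S w)%R]) :
  mu.-integrable setT (EFin \o S) -> mu.-integrable setT (EFin \o X) ->
  \int[mu]_(w in A) (X w)%:E = 0 -> \int[mu]_(w in ~` A) (X w)%:E = 0 ->
  \int[mu]_w `|S w|%R%:E <= \int[mu]_w `|S w + X w|%R%:E.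
Proof.
move=> iS iX XA XC.
have mS : measurable_fun setT S by apply/measurable_EFinP; exact: measurable_int iS.
have mX : measurable_fun setT X by apply/measurable_EFinP; exact: measurable_int iX.
have mA : measurable A.
  have -> : A = setT `&` S @^-1` `[0%R, +oo[%classic.
    by rewrite setTI; apply/seteqP; split => w /=; rewrite in_itv/= andbT.
  exact: mS.
have mC : measurable (~` A) by exact: measurableC.
have split_int (f : T -> R) : measurable_fun setT f ->
    \int[mu]_w `|f w|%R%:E = \int[mu]_(w in A) `|f w|%R%:E
                            + \int[mu]_(w in ~` A) `|f w|%R%:E.
  move=> mf; rewrite -(setUv A) ge0_integral_setU//.
  - by rewrite setUv; apply/measurable_EFinP; exact: measurableT_comp.
  - exact/disj_setPCl.
have iSub B (f : T -> R) : measurable B -> mu.-integrable setT (EFin \o f) ->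
    mu.-integrable B (EFin \o f).
  by move=> mB; apply: integrableS.
rewrite !split_int//; last exact: measurable_funD.
apply: leeD.
- apply: (@le_integral_norm_centered_signed _ _ _ _ _ _ _ 1%R); rewrite ?normr1//.
  + exact: iSub.
  + exact: iSub.
  + by move=> w Aw; rewrite mul1r ger0_norm.
- apply: (@le_integral_norm_centered_signed _ _ _ _ _ _ _ (-1)%R); rewrite ?normrN1//.
  + exact: iSub.
  + exact: iSub.
  + by move=> w /negP; rewrite -ltNge => Sw; rewrite mulN1r ltr0_norm.
Qed.

Section lower_bound.
Context {R : realType} {d : measure_display} {T : measurableType d}.
Context (P : probability T R) (n : nat) (X : 'I_n -> {RV P >-> R}).
Hypothesis mgX : martingale_sums X.

Let S (k : nat) (w : T) : R := (\sum_(i < n | (i < k)%N) X i w)%R.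

Let iX (i : 'I_n) : P.-integrable setT (EFin \o X i).
Proof. by case: mgX. Qed.

Let iS (k : nat) : P.-integrable setT (EFin \o S k).
Proof.
rewrite (_ : EFin \o S k = fun w => \sum_(i < n | (i < k)%N) (X i w)%:E).
  by apply: integrable_sum => // i _; exact: iX.
by apply/funext => w /=; rewrite sumEFin.
Qed.

Let S_recr (k : 'I_n) (w : T) : S k.+1 w = (S k w + X k w)%R.
Proof.
rewrite /S (bigD1 k)//= addrC; congr (_ + _)%R.
by apply: eq_bigl => i; rewrite ltnS ltn_neqAle andbC.
Qed.

(** [S k] is a sum of generators of the past, hence measurable for it; the event is its preimage of
    a half-line. *)
Let past_S (k : 'I_n) : sigma_past X k [set w | (0 <= S k w)%R].
Proof.
pose G := \big[setU/set0]_(j < k) preimage_set_system setT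
  (X (widen_ord (ltnW (ltn_ord k)) j) : T -> R) measurable.
have mXj (j : 'I_k) : @measurable_fun _ _ (g_sigma_algebraType G) R setT
    (X (widen_ord (ltnW (ltn_ord k)) j)).
  move=> _ B mB; apply: sub_sigma_algebra.
  by rewrite /G (bigD1 j)//=; left; exists B.
have mS : @measurable_fun _ _ (g_sigma_algebraType G) R setT (S k).
  rewrite (_ : S k = fun w => \sum_(j < k) X (widen_ord (ltnW (ltn_ord k)) j) w)%R.
    exact: measurable_sum.
  apply/funext => w; rewrite /S (big_ord_narrow (ltnW (ltn_ord k))).
  by [].
rewrite /sigma_past /g_sigma_preimage -/G.
have := mS measurableT `[0%R, +oo[%classic (measurable_itv _).
rewrite setTI; congr (<<s _ >> _).
by apply/seteqP; split => w /=; rewrite in_itv/= andbT.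
Qed.

Let centered (k : 'I_n) (A : set T) : (0 < k)%N -> sigma_past X k A ->
  \int[P]_(w in A) (X k w)%:E = 0.
Proof.
case: mgX => _ /(_ k) + k0 sA => /(_ k0)[_ _ /(_ _ sA)] <-.
exact: integral0.
Qed.

Let norm_S_incr (k : 'I_n) :
  \int[P]_w `|S k w|%R%:E <= \int[P]_w `|S k.+1 w|%R%:E.
Proof.
under [leRHS]eq_integral do rewrite S_recr.
(* The first increment need not be centred, but there [S 0] vanishes. *)
have [k0|k0] := posnP k.
  rewrite (_ : \int[P]_w `|S k w|%R%:E = 0); first by apply: integral_ge0.
  by apply: integral0_eq => w _; rewrite /S k0 big_pred0_eq normr0.
apply: (@le_integral_norm_centered _ _ _ _ (S k) (X k)) => //; apply: centered => //.
have [_ sC _] := smallest_sigma_algebra setT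
  (\big[setU/set0]_(j < k) preimage_set_system setT
    (X (widen_ord (ltnW (ltn_ord k)) j) : T -> R) measurable).
by rewrite -setTD; apply: sC; exact: past_S.
Qed.

Let norm_S_mono (k l : nat) : (k <= l <= n)%N ->
  \int[P]_w `|S k w|%R%:E <= \int[P]_w `|S l w|%R%:E.
Proof.
elim: l => [|l IH]; first by rewrite leqn0 => /andP[/eqP->].
rewrite leq_eqVlt ltnS => /andP[/predU1P[->//|kl] ln].
by rewrite (le_trans (IH _))// ?kl ?(ltnW ln)// (norm_S_incr (Ordinal ln)).
Qed.

Let norm_X_le (k : 'I_n) : \int[P]_w `|X k w|%R%:E <=
  \int[P]_w `|S k.+1 w|%R%:E + \int[P]_w `|S k w|%R%:E.
Proof.
rewrite -integralD//; [|exact: integrable_norm|exact: integrable_norm].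
apply: le_integral => //; first exact: integrable_norm.
  by apply: integrableD => //; exact: integrable_norm.
move=> w _ /=; rewrite -EFinD lee_fin S_recr.
by rewrite (le_trans _ (ler_normB _ _))// addrAC subrr add0r.
Qed.

Let norm_S_le (k : nat) : \int[P]_w `|S k w|%R%:E <=
  \sum_(i < n | (i < k)%N) \int[P]_w `|X i w|%R%:E.
Proof.
rewrite -integral_sum//; last by move=> i; exact: integrable_norm.
apply: le_integral => //; first exact: integrable_norm.
  by apply: integrable_sum => // i _; exact: integrable_norm.
by move=> w _; rewrite /= sumEFin lee_fin; exact: ler_norm_sum.
Qed.

(** The half bound holds at every index; at the first two it follows from the other bounds, a_2 / 2
    being the mean of a_1 and a_2 - a_1. *)
Lemma integral_norm_sums_ge (a : 'I_n -> R) :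
  (forall i : 'I_n, \int[P]_w `|X i w|%R%:E = (a i)%:E) ->
  forall k : 'I_n,
    (a k - \sum_(i < n | (i < k)%N) a i)%R%:E
      <= \int[P]_w `|\sum_(i < n) X i w|%R%:E
    /\ (a k / 2)%R%:E <= \int[P]_w `|\sum_(i < n) X i w|%R%:E.
Proof.
move=> Xa k.
have Sn : \int[P]_w `|\sum_(i < n) X i w|%R%:E = \int[P]_w `|S n w|%R%:E.
  by apply: eq_integral => w _; rewrite /S; under [in RHS]eq_bigl do rewrite ltn_ord.
rewrite {}Sn.
have finS m : \int[P]_w `|S m w|%R%:E \is a fin_num.
  by apply: integrable_fin_num => //; exact: integrable_norm.
have := norm_X_le k; rewrite Xa.
have := norm_S_le k; under eq_bigr do rewrite Xa.
have := @norm_S_mono k.+1 n; rewrite ltn_ord leqnn => /(_ isT).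
have := @norm_S_mono k k.+1; rewrite leqnSn ltn_ord => /(_ isT).
rewrite sumEFin -(fineK (finS n)) -(fineK (finS k)) -(fineK (finS k.+1)).
rewrite -EFinD !lee_fin => h1 h2 h3 h4.
by split; lra.
Qed.

End lower_bound.

(** * Products of a probability space with a biased coin *)

Section product_with_bernoulli.
Context {R : realType} {d : measure_display} {T : measurableType d}.
Context (P : probability T R) (p : R) (p01 : (0 <= p <= 1)%R).
Local Notation B := (bernoulli_prob p).

Lemma measurable_fun_from_bool (D : set bool) (f : bool -> R) :
  measurable_fun D f.
Proof. by []. Qed.

Lemma integral_bernoulli_prob_EFin (f : bool -> R) :
  \int[B]_y (f y)%:E = (p * f true + (1 - p) * f false)%:E.
Proof.
(* The formula for nonnegative integrands is applied to the positive and negative parts. *)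
rewrite integralE !integral_bernoulli_prob//.
rewrite funepos.unlock funeneg.unlock -!(EFinN, EFin_max, EFinM, EFinD) /unstable.onem.
congr EFin.
have pm (x : R) : x = (Num.max x 0 - Num.max (- x) 0)%R.
  by rewrite /Num.max; do 2!case: ifP; lra.
rewrite [in RHS](pm (f true)) [in RHS](pm (f false)); lra.
Qed.

Lemma ge0_integral_prod_bernoulli (f : T * bool -> R) :
  measurable_fun setT f -> (forall z, 0 <= f z)%R ->
  \int[P \x B]_z (f z)%:E =
    p%:E * \int[P]_x (f (x, true))%:E + (1 - p)%:E * \int[P]_x (f (x, false))%:E.
Proof.
move=> mf f0.
rewrite (fubini_tonelli2 (EFin \o f))//; last exact/measurable_EFinP.
rewrite integral_bernoulli_prob// => y.
by apply: integral_ge0 => x _; rewrite lee_fin.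
Qed.

Lemma integrable_prod_bernoulli (f : T * bool -> R) :
  measurable_fun setT f ->
  (forall b, P.-integrable setT (fun x => (f (x, b))%:E)) ->
  (P \x B).-integrable setT (EFin \o f).
Proof.
move=> mf fi; apply/integrableP; split; first exact/measurable_EFinP.
rewrite (ge0_integral_prod_bernoulli (Num.norm \o f)); last 2 first.
- by apply: measurableT_comp => //; exact: normr_measurable.
- by move=> z /=.
have fin b : \int[P]_x (`|f (x, b)|%R)%:E \is a fin_num.
  apply: integrable_fin_num => //.
  exact: (@integrable_norm _ _ _ _ _ (fun x => f (x, b)) (fi b)).
by rewrite -(fineK (fin true)) -(fineK (fin false)) ltry.
Qed.

Lemma measurable_fun_fstM_snd (V : T -> R) (Z : bool -> R) :
  measurable_fun setT V ->
  measurable_fun setT (fun z : T * bool => V z.1 * Z z.2)%R.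
Proof.
move=> mV; apply: measurable_funM; first exact: measurableT_comp.
by apply: measurableT_comp => //; exact: measurable_fun_from_bool.
Qed.

Lemma integrable_fstM_snd (V : T -> R) (Z : bool -> R) :
  P.-integrable setT (EFin \o V) ->
  (P \x B).-integrable setT (EFin \o (fun z => V z.1 * Z z.2)%R).
Proof.
move=> iV; apply: integrable_prod_bernoulli.
  apply: measurable_fun_fstM_snd.
  by apply/measurable_EFinP; exact: measurable_int iV.
by move=> b; under eq_fun do rewrite /= EFinM; exact: integrableZr.
Qed.

(** Fubini on the cylinder above [A]: the coin is independent of the first coordinate, so its mean
    factors out. *)
Lemma integral_fstM_snd (A : set T) (V : T -> R) (Z : bool -> R) :
  measurable A -> P.-integrable setT (EFin \o V) ->
  \int[P \x B]_(z in fst @^-1` A) (V z.1 * Z z.2)%:E =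
    (\int[P]_(x in A) (V x)%:E) * (p * Z true + (1 - p) * Z false)%:E.
Proof.
move=> mA iV.
have mA' : measurable (fst @^-1` A : set (T * bool)).
  by rewrite -[X in measurable X]setTI; exact: measurable_fst.
have iA : P.-integrable A (EFin \o V) by exact: integrableS iV.
rewrite integral_mkcond -integral12_prod_meas1; last first.
  rewrite -integrable_mkcond//; apply: integrableS (integrable_fstM_snd V Z iV) => //.
rewrite -integralZr// [RHS]integral_mkcond.
apply: eq_integral => x _; rewrite /fubini_F !patchE.
case: ifPn => xA; last first.
  apply: integral0_eq => y _; rewrite patchE ifF//.
  by apply/negbTE; apply: contra xA; rewrite !inE.
under eq_integral => y _.
  rewrite patchE ifT/=; last by move: xA; rewrite !inE.
  over.
by rewrite integral_bernoulli_prob_EFin/= -EFinM; congr EFin; lra.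
Qed.

End product_with_bernoulli.

(** * Attainable values of E|S_m|, one increment at a time *)

Lemma g_sigma_preimage_measurable (d d' : measure_display)
    (T : measurableType d) (T' : measurableType d') (n : nat)
    (f : 'I_n -> T -> T') :
  (forall i, measurable_fun setT (f i)) ->
  g_sigma_preimage f `<=` measurable.
Proof.
move=> mf; apply: smallest_sub; first exact: sigma_algebra_measurable.
elim/big_ind : _ => [//|A C AT CT|i _ _ [Y mY <-]]; first by rewrite subUset.
exact: mf.
Qed.

(** Indexing by [nat] makes it easy to append an increment. At [i = 0] the past is the trivial
    sigma-algebra, so the first increment is centred too. *)
Definition martingale_increments {R : realType} {d : measure_display}
    {T : measurableType d} (P : probability T R) (X : nat -> T -> R)
    (m : nat) : Prop :=
  forall i : nat, (i < m)%N ->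
    P.-integrable setT (EFin \o X i) /\
    forall A : set T, g_sigma_preimage (fun j : 'I_i => X j) A ->
      \int[P]_(w in A) (X i w)%:E = 0.

(* The last clause lets a process whose partial sum has vanished be continued
   without almost-everywhere arguments. *)
Definition reachable {R : realType} (a : nat -> R) (m : nat) (s : R) : Prop :=
  exists (d : measure_display) (T : measurableType d) (P : probability T R)
         (X : nat -> T -> R),
    [/\ martingale_increments P X m,
        forall i : nat, (i < m)%N -> \int[P]_w `|X i w|%R%:E = (a i)%:E,
        \int[P]_w `|\sum_(i < m) X i w|%R%:E = s%:E &
        s = 0%R -> forall w, (\sum_(i < m) X i w = 0)%R].

(* New increments have the form U * Z, where U depends on the past only and Z is
   a centred coin toss independent of it. *)
Lemma reachable_product {R : realType} {d : measure_display}
    {T : measurableType d} (P : probability T R) (a : nat -> R) (m : nat) (t : R)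
    (X : nat -> T -> R) (U : T -> R) (p : R) (Z : bool -> R)
    (S := fun w => (\sum_(i < m) X i w)%R) :
  martingale_increments P X m ->
  (forall i : nat, (i < m)%N -> \int[P]_w `|X i w|%R%:E = (a i)%:E) ->
  P.-integrable setT (EFin \o U) ->
  (0 <= p <= 1)%R ->
  (p * Z true + (1 - p) * Z false = 0)%R ->
  \int[P]_w `|U w|%R%:E * (p * `|Z true| + (1 - p) * `|Z false|)%R%:E
    = (a m)%:E ->
  p%:E * \int[P]_w `|S w + U w * Z true|%R%:E
    + (1 - p)%:E * \int[P]_w `|S w + U w * Z false|%R%:E = t%:E ->
  (t = 0%R -> forall w b, (S w + U w * Z b = 0)%R) ->
  reachable a m.+1 t.
Proof.
move=> mgX Xa iU p01 Z0 Ua St S0.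
(* The factor 1 gives old and new increments the same product form. *)
pose Y (i : nat) (z : T * bool) : R :=
  (if i == m then U z.1 * Z z.2 else X i z.1 * 1)%R.
have Ym : Y m = (fun z => U z.1 * Z z.2)%R by rewrite /Y eqxx.
have YX i : (i < m)%N -> Y i = (fun z => X i z.1 * 1)%R.
  by move=> im; rewrite /Y ltn_eqF.
have sumY z : (\sum_(i < m.+1) Y i z = S z.1 + U z.1 * Z z.2)%R.
  rewrite big_ord_recr/= Ym; congr (_ + _)%R.
  by apply: eq_bigr => i _; rewrite YX// mulr1.
have mX i : (i < m)%N -> measurable_fun setT (X i).
  by move=> /mgX[iX _]; apply/measurable_EFinP; exact: measurable_int iX.
have mU : measurable_fun setT U.
  by apply/measurable_EFinP; exact: measurable_int iU.
have one1 : (p * 1 + (1 - p) * 1 = 1)%R by lra.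
exists _, (T * bool)%type, (P \x bernoulli_prob p), Y; split.
- move=> i; rewrite ltnS => im; split.
    move: im; rewrite leq_eqVlt => /predU1P[->|im].
      rewrite Ym; exact: integrable_fstM_snd.
    rewrite YX//; apply: (integrable_fstM_snd _ _ _ _ (cst 1%R)) => //.
    by have [] := mgX _ im.
  (* Past events of [Y] are cylinders above past events [C] of [X]. *)
  have -> : (fun j : 'I_i => Y j) = (fun j : 'I_i => X j \o fst).
    apply/funext => j; rewrite YX ?(leq_trans (ltn_ord j))//.
    by apply/funext => z /=; rewrite mulr1.
  rewrite (g_sigma_preimage_comp (fun j : 'I_i => X j) fst) => A [C sC <-].
  rewrite setTI.
  have mC : measurable C.
    apply: g_sigma_preimage_measurable sC => j.
    by apply: mX; rewrite (leq_trans (ltn_ord j)).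
  (* The new increment is centred on the cylinder because [Z] is, an old one because [X] was. *)
  move: im; rewrite leq_eqVlt => /predU1P[im|im].
    rewrite im; rewrite Ym.
    by rewrite integral_fstM_snd// Z0 mule0.
  have [iX XC] := mgX _ im.
  rewrite YX// (integral_fstM_snd _ _ _ _ _ (cst 1%R))// one1 mule1.
  exact: XC.
- have intN (V : T -> R) (W : bool -> R) : P.-integrable setT (EFin \o V) ->
      \int[P \x bernoulli_prob p]_z `|V z.1 * W z.2|%R%:E =
      \int[P]_w `|V w|%R%:E * (p * `|W true| + (1 - p) * `|W false|)%R%:E.
    move=> iV; rewrite -(integral_fstM_snd P p p01 setT (Num.norm \o V) (Num.norm \o W))//.
      by rewrite preimage_setT; under eq_integral do rewrite normrM.
    exact: integrable_norm.
  move=> i; rewrite ltnS leq_eqVlt => /predU1P[->|im].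
    by rewrite Ym; rewrite intN.
  have [iX _] := mgX _ im.
  by rewrite YX// (intN _ (cst 1%R))// normr1 one1 mule1 Xa.
- under eq_integral do rewrite sumY.
  rewrite (ge0_integral_prod_bernoulli P p p01
    (fun z => `|S z.1 + U z.1 * Z z.2|%R))//.
  apply: measurableT_comp; first exact: normr_measurable.
  apply: measurable_funD; last exact: measurable_fun_fstM_snd.
  apply: measurableT_comp => //.
  by apply: measurable_sum => i; exact: mX.
- by move=> /S0 S0' z; rewrite sumY.
Qed.

Section reachable_steps.
Context {R : realType} (a : nat -> R).

Lemma reachable0 : reachable a 0 0.
Proof.
exists _, bool, (bernoulli_prob 1%R : probability bool R), (fun _ _ => 0%R).
split => [//|//||_ w]; last by rewrite big_ord0.
by apply: integral0_eq => w _; rewrite big_ord0 normr0.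
Qed.

(** From a sum that is identically zero, add [a m] times a fair sign. *)
Lemma reachable_start (m : nat) : (0 <= a m)%R -> reachable a m 0 ->
  reachable a m.+1 (a m).
Proof.
move=> am [d [T [P [X [mgX Xa _ /(_ erefl) X0]]]]].
have intc (r : R) : \int[P]_w (`|r|%R)%:E = `|r|%R%:E.
  by rewrite integral_cst//= probability_setT mule1.
apply: (reachable_product P a m (a m) X (cst (a m)) (1 / 2)
  (fun b => if b then 1 else -1)%R) => //.
- exact: finite_measure_integrable_cst.
- lra.
- lra.
- by rewrite /= intc -EFinM normrN1 normr1 ger0_norm//; congr EFin; lra.
- under eq_integral do rewrite X0 add0r.
  under [in X in _ + X]eq_integral do rewrite X0 add0r.
  rewrite /= !intc -!EFinM -EFinD mulrN normrN mulr1 ger0_norm//.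
  by congr EFin; lra.
- by move=> am0 w b; rewrite X0 am0 mul0r addr0.
Qed.

Lemma reachable_stay (m : nat) (s : R) : a m = 0%R -> reachable a m s ->
  reachable a m.+1 s.
Proof.
move=> am [d [T [P [X [mgX Xa Xs X0]]]]].
apply: (reachable_product P a m s X (cst 0%R) 1 (cst 0%R)) => //.
- exact: finite_measure_integrable_cst.
- by rewrite lexx ler01.
- by rewrite !mulr0 addr0.
- by rewrite am; under eq_integral do rewrite normr0; rewrite integral0 mul0e.
- rewrite subrr mul0e adde0 mul1e -Xs.
  by under eq_integral do rewrite mulr0 addr0.
- by move=> s0 w b; rewrite X0// mulr0 addr0.
Qed.

(* With U = S, the two values of Z are chosen so that 1 + Z is positive on one
   branch and nonpositive on the other; then E|1 + Z| is affine in p. *)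
Lemma reachable_move (m : nat) (s t : R) : (0 < s)%R -> (0 < a m)%R ->
  (s <= t < s + a m)%R -> (a m < s + t)%R ->
  reachable a m s -> reachable a m.+1 t.
Proof.
move=> s0 b0 /andP[st ts] bt [d [T [P [X [mgX Xa Xs X0]]]]].
set b := a m in b0 ts bt *.
pose S w := (\sum_(i < m) X i w)%R.
pose u := (t + s - b)%R; pose v := (s + b - t)%R.
(* Since [u + v = 2 * s], the weights [u / (2 * s)] and [v / (2 * s)] sum to 1. The jumps [b / u]
   and [- b / v] of [Z] each contribute [b / 2] to the moment of the increment. *)
have u0 : (0 < u)%R by rewrite /u; lra.
have v0 : (0 < v)%R by rewrite /v; lra.
have us : (u / (2 * s) = 1 - v / (2 * s))%R by rewrite /u /v; field; lra.
have iS : P.-integrable setT (EFin \o S).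
  rewrite (_ : _ \o _ = fun w => \sum_(i < m) (X i w)%:E).
    by apply: integrable_sum => // i _; have [] := mgX _ (ltn_ord i).
  by apply/funext => w /=; rewrite sumEFin.
have intS (z : R) :
    \int[P]_w `|S w + S w * z|%R%:E = (s * `|1 + z|)%R%:E.
  under eq_integral do rewrite -{1}(mulr1 (S _)) -mulrDr normrM EFinM.
  by rewrite integralZr// ?Xs -?EFinM//; exact: integrable_norm.
apply: (reachable_product P a m t X S (u / (2 * s))
  (fun y => if y then b / u else - (b / v))%R) => //.
- apply/andP; split; first by rewrite divr_ge0 ?ltW ?mulr_gt0.
  by rewrite us -subr_ge0 opprB addrC subrK divr_ge0 ?ltW ?mulr_gt0.
- by rewrite /u /v; field; rewrite -/u -/v; lra.
- rewrite Xs -EFinM normrN !gtr0_norm ?divr_gt0//; congr EFin.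
  by rewrite -/b /u /v; field; lra.
- rewrite !intS -!EFinM -EFinD; congr EFin.
  have -> : (1 + b / u = (t + s) / u)%R by rewrite /u; field; lra.
  have -> : (1 - b / v = - ((t - s) / v))%R by rewrite /v; field; lra.
  rewrite normrN !ger0_norm; last 2 first.
  + by apply: divr_ge0; [lra|exact: ltW].
  + by apply: divr_ge0; [lra|exact: ltW].
  by rewrite /u /v; field; lra.
- by move=> t0; lra.
Qed.

End reachable_steps.

(** * Choice of the moments *)

Lemma exists_le_positive_values {R : realType} (a : nat -> R) (n : nat) :
  exists2 c : R, (0 < c <= 1)%R &
    forall i : nat, (i < n)%N -> (0 < a i)%R -> (c <= a i)%R.
Proof.
elim: n => [|n [c /andP[c0 c1] ca]]; first by exists 1%R; rewrite ?ltr01 ?lexx.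
have [an|an] := ltP 0%R (a n).
  exists (Num.min c (a n)).
    by rewrite lt_min c0 an ge_min c1.
  move=> i; rewrite ltnS leq_eqVlt => /predU1P[-> _|ilt ai].
    by rewrite ge_min lexx orbT.
  by rewrite ge_min ca.
exists c; first by rewrite c0 c1.
move=> i; rewrite ltnS leq_eqVlt => /predU1P[->|ilt ai]; last exact: ca.
by rewrite ltNge an.
Qed.

(* The moments E|S_k| are driven towards M + e as fast as possible: each one is
   the minimum of M + e and the previous one plus (1 - D) a_k. The factor
   1 - D keeps every step away from the upper bound E|S_(k-1)| + a_k, which
   is not attained. *)
Lemma reachable_le {R : realType} (a : nat -> R) (n : nat) (M e : R) :
  (0 <= M)%R -> (0 < e)%R ->
  (forall i : nat, (0 <= a i)%R) ->
  (forall k : nat, (k < n)%N -> (a k - \sum_(i < k) a i <= M)%R) ->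
  (forall k : nat, (2 <= k < n)%N -> (a k / 2 <= M)%R) ->
  exists2 s : R, (s <= M + e)%R & reachable a n s.
Proof.
move=> M0 e0 a0 aM a2M.
have [c /andP[c0 c1] ca] := exists_le_positive_values a n.
pose A k := (\sum_(i < k) a i)%R.
have AS k : A k.+1 = (A k + a k)%R by rewrite /A big_ord_recr.
have A_ge0 k : (0 <= A k)%R by apply: sumr_ge0.
have A_le k l : (k <= l)%N -> (A k <= A l)%R.
  move=> /subnK <-; elim: (l - k)%N => [|j IH]; first by rewrite add0n.
  by rewrite addSn AS (le_trans IH)// lerDl.
(* Chosen so that the total loss [D * A n] stays below both [e] and [c]; also [D <= c <= 1]. *)
pose D := (Num.min e c / (A n + 1))%R.
have m0 : (0 < Num.min e c)%R by rewrite lt_min e0 c0.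
have An1 : (0 < A n + 1)%R by rewrite ltr_wpDl.
have D0 : (0 < D)%R by rewrite divr_gt0.
have DA1 : (D * (A n + 1) = Num.min e c)%R by rewrite /D divfK// gt_eqF.
have DAe : (D * A n + D <= e)%R.
  by rewrite -{2}(mulr1 D) -mulrDr DA1 ge_min lexx.
have DAc : (D * A n + D <= c)%R.
  by rewrite -{2}(mulr1 D) -mulrDr DA1 ge_min lexx orbT.
have DA k : (k <= n)%N -> (0 <= D * A k <= D * A n)%R.
  move=> kn; apply/andP; split; first by rewrite mulr_ge0// ltW.
  by apply: ler_wpM2l; [exact: ltW|exact: A_le].
(* Invariant: either all moments so far vanish, or [s >= c] and [s] has reached the cap [M + e] or
   lost at most [D * A m] against [A m]. The cap is first reached after two steps or more, when the
   half bound applies. *)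
suff H m : (m <= n)%N -> exists s, [/\ reachable a m s, (s <= M + e)%R &
    (s = 0%R /\ A m = 0%R) \/
    [/\ (0 < m)%N, (c <= s)%R & (M + e <= s /\ (2 <= m)%N)%R \/ (A m - D * A m <= s)%R]].
  by have [s [rs sM _]] := H _ (leqnn n); exists s.
elim: m => [_|m IH mn].
  exists 0%R; split; [exact: reachable0|lra|left; split => //].
  by rewrite /A big_ord0.
have [s [rs sM Hs]] := IH (ltnW mn).
have am0 := a0 m.
have := DA _ mn; rewrite AS mulrDr => /andP[_ DA'].
have /andP[DAm _] := DA _ (ltnW mn).
have Dam : (0 <= D * a m)%R by rewrite mulr_ge0// ltW.
have Dam_le : (D * a m <= a m)%R.
  by apply: ler_piMl => //; move: DAm DA'; lra.
have aMm := aM _ mn; rewrite -/(A m) in aMm.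
case: Hs => [[s_0 Am]|[m_gt0 cs Hs]].
  (* With [A m = 0], the hypothesis gives [a m <= M]: this start stays below the cap. *)
  rewrite {}s_0 in rs sM.
  exists (a m); split; [exact: reachable_start|lra|].
  have [am|am] := ltP 0%R (a m); last by left; split; lra.
  by right; split => //; [exact: ca|right; lra].
have [am|am] := ltP 0%R (a m); last first.
  have am_0 : a m = 0%R by lra.
  exists s; split => //; first exact: reachable_stay.
  right; split => //; case: Hs => [[h1 h2]|h]; [left|right; rewrite am_0]; last lra.
  by split=> //; exact: ltnW.
have Dam_gt0 : (0 < D * a m)%R by rewrite mulr_gt0.
(* Jumping to the cap requires [a m < s + (M + e)]: at the cap use [a m <= 2 * M], below it
   [a m <= M + A m] and [D * A m < e]. *)
have [h|h] := leP (M + e)%R (s + (a m - D * a m))%R.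
  exists (M + e)%R; split => //; last first.
    by right; split => //; [lra|left; split].
  apply: (reachable_move _ _ s) => //; [lra|apply/andP; split; lra|].
  case: Hs => [[h1 h2]|h1]; last by lra.
  by have := a2M m; rewrite h2 mn => /(_ isT); lra.
(* Here [reachable_move] requires [D * a m < 2 * s], which follows from [D * a m < c <= s]. *)
exists (s + (a m - D * a m))%R; split; [|lra|].
  apply: (reachable_move _ _ s) => //; [lra|apply/andP; split|]; lra.
right; split => //; first by lra.
case: Hs => [[h1 h2]|h1]; last by right; lra.
by left; split; [lra|exact: ltnW].
Qed.

(** * From attainable values to the infimum *)

(** Vanishing integrals over past events say that 0 is a version of the conditional expectation. *)
Lemma f_MG_le_reachable {R : realType} (n : nat) (a : 'I_n -> R) (b : nat -> R)
    (s : R) :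
  (forall i : 'I_n, b i = a i) -> reachable b n s -> f_MG a <= s%:E.
Proof.
move=> ba [d [T [P [X [mgX Xb Xs _]]]]].
have mX (i : 'I_n) : measurable_fun setT (X i).
  by have [iX _] := mgX _ (ltn_ord i); apply/measurable_EFinP; exact: measurable_int iX.
pose Y (i : 'I_n) : {RV P >-> R} :=
  HB.pack (X i) (isMeasurableFun.Build _ _ _ _ (X i) (mX i)).
apply: ereal_inf_lbound; exists d, T, P, Y; split.
- split=> [i|i _]; first by have [] := mgX _ (ltn_ord i).
  have [iX X0] := mgX _ (ltn_ord i).
  split=> [B mB||A sA].
  + rewrite /sigma_past /g_sigma_preimage.
    set G := \big[_/_]_(_ < _) _.
    have := @measurable_cst _ _ (g_sigma_algebraType G) R setT 0%R measurableT B mB.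
    by rewrite setTI.
  + exact: integrable0.
  + by rewrite integral0 X0.
- by move=> i; rewrite unlock Xb// ba.
- by rewrite unlock Xs.
Qed.

(* -oo is the neutral element of maxe, i.e. the maximum of the empty set. *)
Theorem theorem1p1 (R : realType) (n : nat) (hn : (0 < n)%N) (a : 'I_n -> R)
    (ha : forall k : 'I_n, (0 <= a k)%R) :
  f_MG a =
  maxe (\big[maxe/-oo]_(k < n) (a k - \sum_(i < n | (i < k)%N) a i)%R%:E)
       (\big[maxe/-oo]_(k < n | (2 <= k)%N) (a k / 2)%R%:E).
Proof.
set rhs := maxe _ _.
apply/eqP; rewrite eq_le; apply/andP; split; last first.
  apply/ereal_infP => _ [d [T [P [X [mgX Xa ->]]]]].
  have {}Xa (i : 'I_n) : \int[P]_w `|X i w|%R%:E = (a i)%:E.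
    by rewrite -Xa unlock.
  have ge := integral_norm_sums_ge P n X mgX a Xa.
  rewrite unlock ge_max; apply/andP; split.
    by apply: bigmax_le => [|k _]; [exact: leNye|have [] := ge k].
  by apply: bigmax_le => [|k _]; [exact: leNye|have [] := ge k].
have rhs1 (k : 'I_n) : (a k - \sum_(i < n | (i < k)%N) a i)%R%:E <= rhs.
  by rewrite le_max; apply/orP; left; exact: (le_bigmax_cond _ _ (j := k)).
have rhs2 (k : 'I_n) : (2 <= k)%N -> (a k / 2)%R%:E <= rhs.
  by move=> k2; rewrite le_max; apply/orP; right; exact: (le_bigmax_cond _ _ (j := k)).
(* The value +oo makes the bound trivial; -oo is excluded by the first index, which exists since
   [0 < n]. *)
case: rhs rhs1 rhs2 => [M| |] rhs1 rhs2; last 2 first.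
- exact: leey.
- by have := rhs1 (Ordinal hn); rewrite leeNy_eq.
(* Extension of [a] by zero beyond [n]. *)
pose b (k : nat) : R := if insub k is Some i then a i else 0%R.
have ba (i : 'I_n) : b i = a i by rewrite /b valK.
have b0 k : (0 <= b k)%R by rewrite /b; case: insub.
have bM k : (k < n)%N -> (b k - \sum_(i < k) b i <= M)%R.
  move=> kn; have := rhs1 (Ordinal kn); rewrite lee_fin -ba /=.
  rewrite (big_ord_widen _ _ (ltnW kn)).
  by under [in X in _ -> X]eq_bigr do rewrite ba.
apply/lee_addgt0Pr => e e0.
(* At index 0 the subtracted sum is empty, so [0 <= b 0 <= M]. *)
have M0 : (0 <= M)%R.
  by have := bM _ hn; rewrite big_ord0 subr0; apply: le_trans.
have [|s sM] := reachable_le b n M e M0 e0 b0 bM.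
  move=> k /andP[k2 kn]; have := rhs2 (Ordinal kn) k2.
  by rewrite lee_fin -ba.
move=> /(f_MG_le_reachable n a b s ba) /le_trans; apply.
by rewrite -EFinD lee_fin.
Qed.
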